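(* Let $\mathcal{A}$ be a $C^*$-algebra, let $\mathcal{M}$ be a pre-Hilbert $\mathcal{A}$-module and let $\mathcal{N}$ be a Hilbert $\mathcal{A}$-module. Let $D\subseteq\mathcal{M}\times\mathcal{M}$ and put $\Delta=\{x\in\mathcal{M}:(x,x)\in D\}$. Suppose that $\Delta\times\Delta\subseteq D$ and that $c\neq 1$ is a positive real number such that: (i) for all $(x,y)\in D$ and all $m,n\in\mathbb{N}_0$, $(c^{-n}x,c^{-m}y)\in D$; (ii) for all $x,y\in\mathcal{M}\setminus\{0\}$ there are $m,n\in\mathbb{N}_0$ with $(c^{-n}x,c^{-m}y)\in D$. Let $\varphi:\mathcal{M}\times\mathcal{M}\to[0,\infty)$ satisfy $$\lim_{m+n\to\infty}c^{m+n}\varphi(c^{-m}x,c^{-n}y)=0\qquad\text{for all }(x,y)\in D,$$ and let $f:\mathcal{M}\to\mathcal{N}$ be a mapping such that $$\|\langle f(x),f(y)\rangle-\langle x,y\rangle\|\le\varphi(x,y)\qquad\text{for all }(x,y)\in D.$$ Then there exist a unique $\mathcal{A}$-linear isometry $I:\mathcal{M}\to\mathcal{N}$ and a mapping $T:\mathcal{M}\to\mathcal{N}$ such that $$f(x)=I(x)+T(x),\qquad \|f(x)-I(x)\|\le\sqrt{\varphi(x,x)},\qquad \|T(x)\|\le\sqrt{\varphi(x,x)},\qquad \langle T(x),I(y)\rangle=0$$ for all $x,y\in\Delta$.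
   Context: $\mathbb{N}_0$ denotes the non-negative integers. Let $\mathcal{A}$ be a $C^*$-algebra. A pre-Hilbert $\mathcal{A}$-module is a complex linear space $\mathcal{M}$ which is an algebraic left $\mathcal{A}$-module with $\lambda(ax)=a(\lambda x)=(\lambda a)x$ ($x\in\mathcal{M}$, $a\in\mathcal{A}$, $\lambda\in\mathbb{C}$), equipped with an $\mathcal{A}$-valued inner product $\langle\cdot,\cdot\rangle:\mathcal{M}\times\mathcal{M}\to\mathcal{A}$ satisfying: $\langle x,x\rangle\ge 0$ in $\mathcal{A}$, and $\langle x,x\rangle=0$ iff $x=0$; $\langle\lambda x+y,z\rangle=\lambda\langle x,z\rangle+\langle y,z\rangle$; $\langle ax,y\rangle=a\langle x,y\rangle$; $\langle x,y\rangle^*=\langle y,x\rangle$. It is normed by $\|x\|=\|\langle x,x\rangle\|^{1/2}$, and is called a Hilbert $\mathcal{A}$-module if it is complete in this norm. A mapping $I:\mathcal{M}\to\mathcal{N}$ is $\mathcal{A}$-linear if $I(ax+\lambda y+z)=aI(x)+\lambda I(y)+I(z)$ for all $a\in\mathcal{A}$, $x,y,z\in\mathcal{M}$, $\lambda\in\mathbb{C}$; it is an isometry if $\|I(x)-I(y)\|=\|x-y\|$ for all $x,y\in\mathcal{M}$. The limit $\lim_{m+n\to\infty}$ is over pairs $m,n\in\mathbb{N}_0$ with $m+n\to\infty$. *)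

(* Defs.v *)
From HB Require Import structures.
From mathcomp Require Import all_boot all_order all_algebra.
From mathcomp Require Import complex.
From mathcomp Require Import all_classical all_reals all_analysis.

Set Implicit Arguments.
Unset Strict Implicit.
Unset Printing Implicit Defensive.

Import Order.TTheory GRing.Theory Num.Theory.
Import numFieldNormedType.Exports.

Local Open Scope classical_set_scope.
Local Open Scope complex_scope.
Local Open Scope ring_scope.

(* The multiplication of a C*-algebra is a separate operation [amul], not that
   of a MathComp ring: MathComp rings are unital, C*-algebras need not be. *)
HB.mixin Record CompleteNormedModule_isCStarAlgebra (R : realType) A
    of CompleteNormedModule R[i] A := {
  amul : A -> A -> A;
  astar : A -> A;
  amulA : forall a b c, amul a (amul b c) = amul (amul a b) c;
  amulDl : forall a b c, amul (a + b) c = amul a c + amul b c;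
  amulDr : forall a b c, amul a (b + c) = amul a b + amul a c;
  amulZl : forall (l : R[i]) a b, amul (l *: a) b = l *: amul a b;
  amulZr : forall (l : R[i]) a b, amul a (l *: b) = l *: amul a b;
  anormM : forall a b, `|amul a b| <= `|a| * `|b|;
  astarD : forall a b, astar (a + b) = astar a + astar b;
  astarZ : forall (l : R[i]) a, astar (l *: a) = Num.conj l *: astar a;
  astarM : forall a b, astar (amul a b) = amul (astar b) (astar a);
  astarK : forall a, astar (astar a) = a;
  cstar_identity : forall a, `|amul (astar a) a| = `|a| ^+ 2
}.

#[short(type="cstarAlgType")]
HB.structure Definition CStarAlgebra (R : realType) :=
  {A of CompleteNormedModule R[i] A & CompleteNormedModule_isCStarAlgebra R A}.

Section Positivity.
Context {R : realType} {A : cstarAlgType R}.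

(* The product of the unitization A (+) C, whose unit is (0, 1). *)
Definition unitize_mul (s t : A * R[i]) : A * R[i] :=
  (amul s.1 t.1 + t.2 *: s.1 + s.2 *: t.1, s.2 * t.2).

(* The spectrum is taken in the unitization; when A already has a unit this
   only adds the point 0, which does not affect positivity. *)
Definition spectrum (a : A) : set R[i] :=
  [set l | ~ exists s, unitize_mul (a, - l) s = (0, 1) /\
                       unitize_mul s (a, - l) = (0, 1)].

(* On R[i], [0 <= l] says that l is a real number and nonnegative. *)
Definition apositive (a : A) : Prop :=
  astar a = a /\ forall l, spectrum a l -> 0 <= l.

(* The norm of a normed space over R[i] takes its (real) values in R[i];
   [anorm] is the same norm with values in R. *)
Definition anorm (a : A) : R := complex.Re `|a|.

End Positivity.

HB.mixin Record Lmodule_isPreHilbert (R : realType) (A : cstarAlgType R) M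
    of GRing.Lmodule R[i] M := {
  act : A -> M -> M;
  inner : M -> M -> A;
  actDl : forall a b x, act (a + b) x = act a x + act b x;
  actDr : forall a x y, act a (x + y) = act a x + act a y;
  actM : forall a b x, act (amul a b) x = act a (act b x);
  actZr : forall (l : R[i]) a x, l *: act a x = act a (l *: x);
  actZl : forall (l : R[i]) a x, l *: act a x = act (l *: a) x;
  inner_ge0 : forall x, apositive (inner x x);
  inner_eq0 : forall x, inner x x = 0 <-> x = 0;
  inner_linearl : forall (l : R[i]) x y z,
    inner (l *: x + y) z = l *: inner x z + inner y z;
  inner_actl : forall a x y, inner (act a x) y = amul a (inner x y);
  inner_star : forall x y, astar (inner x y) = inner y x
}.

#[short(type="preHilbertModType")]
HB.structure Definition PreHilbertModule (R : realType) (A : cstarAlgType R) :=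
  {M of GRing.Lmodule R[i] M & Lmodule_isPreHilbert R A M}.

Definition hnorm {R : realType} {A : cstarAlgType R} {M : preHilbertModType A}
  (x : M) : R := Num.sqrt (anorm (inner x x : A)).

HB.mixin Record PreHilbertModule_isComplete (R : realType)
    (A : cstarAlgType R) M of PreHilbertModule R A M := {
  hnorm_complete : forall u : nat -> M,
    (forall e : R, 0 < e ->
       exists K : nat, forall m n, (K <= m)%N -> (K <= n)%N ->
         hnorm (u m - u n) < e) ->
    exists x : M, hnorm (u n - x) @[n --> \oo] --> (0 : R)
}.

#[short(type="hilbertModType")]
HB.structure Definition HilbertModule (R : realType) (A : cstarAlgType R) :=
  {M of PreHilbertModule R A M & PreHilbertModule_isComplete R A M}.

Section Maps.
Context {R : realType} {A : cstarAlgType R} {M N : preHilbertModType A}.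

Definition Alinear (I : M -> N) : Prop :=
  forall (a : A) (l : R[i]) (x y z : M),
    I (act a x + l *: y + z) = act a (I x) + l *: I y + I z.

Definition hisometry (I : M -> N) : Prop :=
  forall x y : M, hnorm (I x - I y) = hnorm (x - y).

End Maps.

(* The filter of pairs (m, n) with m + n --> oo. *)
Definition sum_oo : set_system (nat * nat) :=
  [set P | exists K : nat, forall p, (K <= p.1 + p.2)%N -> P p].

Global Instance sum_oo_filter : ProperFilter sum_oo.
Proof.
split; first by case=> K /(_ (K, 0%N)); apply; rewrite addn0.
split=> [|P Q [K PK] [L QL]|P Q PQ [K PK]]; first by exists 0%N.
- exists (maxn K L) => p; rewrite geq_max => /andP[Kp Lp].
  by split; [exact: PK|exact: QL].
- by exists K => p /PK /PQ.
Qed.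

(* Main.v *)
(** I is the limit of the rescalings c^n f(c^(-n) x): the hypotheses on phi make
    the inner products <c^m f(c^(-m) x), c^n f(c^(-n) y)> converge to <x, y>, so
    the rescalings are Cauchy and their limit preserves inner products, which
    makes it A-linear and isometric.  Letting only one of the two indices tend
    to infinity gives <I x, f y> = <x, y>, hence the orthogonality of f - I and I.

    Passing to the limit needs continuity of the inner product, i.e. a
    Cauchy-Schwarz inequality, which rests on |a| <= |a + b| for positive a, b
    of a C*-algebra.  Positivity being spectral, one needs that a symmetric
    operator T on A with h - T and h + T bounded below for all h > r has norm at
    most r; applied to t - a this gives |t x - a x| <= t |x| for a >= 0, t >= |a|,
    and applied to a it gives |a| <= |a + b|. *)

Require Import Defs.
From HB Require Import structures.
From mathcomp Require Import all_boot all_order all_algebra.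
From mathcomp Require Import complex.
From mathcomp Require Import all_classical all_reals all_analysis.
From mathcomp Require Import ring lra.

Set Implicit Arguments.
Unset Strict Implicit.
Unset Printing Implicit Defensive.

Import Order.TTheory GRing.Theory Num.Theory.
Import numFieldNormedType.Exports.

Local Open Scope classical_set_scope.
Local Open Scope complex_scope.
Local Open Scope ring_scope.

(** * Symmetric operators and positivity in C*-algebras *)

Section CStarAlgebraTheory.
Context {R : realType} {A : cstarAlgType R}.
Implicit Types (a b u v w x y : A) (S T : A -> A).

Lemma real_complexB (r s : R) : (r - s)%:C = r%:C - s%:C.
Proof. exact: rmorphB. Qed.

Lemma real_complexM (r s : R) : (r * s)%:C = r%:C * s%:C.
Proof. exact: rmorphM. Qed.

Lemma normc_real (r : R) : `|r%:C| = `|r|%:C.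
Proof. by rewrite normc_def /= expr0n addr0 sqrtr_sqr. Qed.

Lemma anormE a : (anorm a)%:C = `|a|.
Proof. by rewrite /anorm RRe_real // ger0_real. Qed.

Lemma anorm_ge0 a : 0 <= anorm a.
Proof. by rewrite -ler0c anormE. Qed.

Lemma anorm0 : anorm (0 : A) = 0.
Proof. by rewrite /anorm normr0. Qed.

Lemma anorm_eq0 a : (anorm a == 0) = (a == 0).
Proof. by rewrite -(inj_eq (@complexI R)) anormE normr_eq0. Qed.

Lemma anormN a : anorm (- a) = anorm a.
Proof. by rewrite /anorm normrN. Qed.

Lemma anormD a b : anorm (a + b) <= anorm a + anorm b.
Proof. by rewrite -lecR rmorphD /= !anormE ler_normD. Qed.

Lemma anormB a b : anorm (a - b) <= anorm a + anorm b.
Proof. by rewrite -(anormN b) anormD. Qed.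

Lemma anorm_leB a b : anorm a <= anorm (a - b) + anorm b.
Proof. by rewrite -{1}(subrK b a) anormD. Qed.

Lemma anormZ (r : R) a : anorm (r%:C *: a) = `|r| * anorm a.
Proof.
by apply: (@complexI R); rewrite real_complexM !anormE normrZ normc_real.
Qed.

Lemma anormZl (l : R[i]) a : anorm (l *: a) = complex.Re `|l| * anorm a.
Proof.
apply: (@complexI R).
by rewrite real_complexM !anormE normrZ RRe_real // ger0_real.
Qed.

Lemma anorm_mul a b : anorm (amul a b) <= anorm a * anorm b.
Proof. by rewrite -lecR real_complexM !anormE anormM. Qed.

Lemma anorm_starM a : anorm (amul (astar a) a) = anorm a ^+ 2.
Proof.
apply: (@complexI R).
by rewrite expr2 real_complexM !anormE cstar_identity expr2.
Qed.

Lemma amul0l b : amul 0 b = 0.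
Proof. by have := amulZl 0 (0 : A) b; rewrite !scale0r. Qed.

Lemma amulNl a b : amul (- a) b = - amul a b.
Proof. by rewrite -scaleN1r amulZl scaleN1r. Qed.

Lemma amulNr a b : amul a (- b) = - amul a b.
Proof. by rewrite -scaleN1r amulZr scaleN1r. Qed.

Lemma astar_real (r : R) a : astar (r%:C *: a) = r%:C *: astar a.
Proof. by rewrite astarZ conj_Creal //; apply/complex_realP; exists r. Qed.

Lemma astarN a : astar (- a) = - astar a.
Proof. by rewrite -[in LHS]scaleN1r astarZ rmorphN1 scaleN1r. Qed.

(** Since |a|^2 = |a^* a| <= |a^*| |a|, a nonzero factor |a| cancels. *)
Lemma anorm_star_le a : anorm a <= anorm (astar a).
Proof.
have [->|a0] := eqVneq a 0; first by rewrite anorm0 anorm_ge0.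
have apos : 0 < anorm a by rewrite lt_def anorm_eq0 a0 anorm_ge0.
rewrite -(ler_pM2r apos) -expr2 -anorm_starM; exact: anorm_mul.
Qed.

Lemma anorm_star a : anorm (astar a) = anorm a.
Proof.
by apply/eqP; rewrite eq_le anorm_star_le -{2}[a]astarK anorm_star_le.
Qed.

Lemma starM_eq0 w : amul (astar w) w = 0 -> w = 0.
Proof.
move=> ww; apply/eqP; rewrite -anorm_eq0 -sqrf_eq0 -anorm_starM ww.
by rewrite anorm0.
Qed.

Lemma conjc_i : Num.conj ('i%C : R[i]) = - 'i%C.
Proof. by rewrite complexiE conjCi. Qed.

Lemma mulii : ('i%C * 'i%C : R[i]) = -1.
Proof. by rewrite -expr2 sqr_i. Qed.

(** The hypothesis makes w^*w + v^*v equal to z^*z for both z = w + iv and z = w - iv; these have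
    the same norm, and 2iv is their difference. *)
Lemma anorm_sqrD w v : amul (astar w) v = amul (astar v) w ->
  anorm v ^+ 2 <= anorm (amul (astar w) w + amul (astar v) v).
Proof.
move=> wv; set q := (X in _ <= anorm X).
have qp : anorm q = anorm (w + 'i%C *: v) ^+ 2.
  rewrite -anorm_starM astarD astarZ conjc_i !(amulDl, amulDr, amulZl, amulZr).
  rewrite scaleNr wv scaleNr scalerA mulii scaleN1r opprK.
  by rewrite addrA addrK.
have qm : anorm q = anorm (w - 'i%C *: v) ^+ 2.
  rewrite -anorm_starM -scaleNr astarD astarZ rmorphN /= conjc_i opprK.
  rewrite !(amulDl, amulDr, amulZl, amulZr) wv scalerA.
  by rewrite mulrN mulii opprK scale1r scaleNr addrA subrK.
have i2 : 2 * anorm v <= anorm (w + 'i%C *: v) + anorm (w - 'i%C *: v).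
  suff -> : 2 * anorm v = anorm ((w + 'i%C *: v) - (w - 'i%C *: v)).
    exact: anormB.
  rewrite opprB addrC -addrA [- w + _]addrA addNr add0r -scalerDl.
  rewrite anormZl; congr (_ * _).
  rewrite normc_def /= addr0 expr0n add0r sqrtr_sqr ger0_norm //; lra.
have eqn : anorm (w + 'i%C *: v) = anorm (w - 'i%C *: v).
  apply/eqP; rewrite -(eqrXn2 (n := 2)) ?anorm_ge0 //; apply/eqP.
  by rewrite -qp -qm.
have : anorm v <= anorm (w + 'i%C *: v) by lra.
by rewrite qp => h; rewrite lerXn2r // nnegrE anorm_ge0.
Qed.

(* Adjointness for the A-valued form [x^* y] on A itself; it forces linearity.
   Working with such operators replaces the operator norm of the unitization. *)
Definition symmetric_op T :=
  forall x y, amul (astar (T x)) y = amul (astar x) (T y).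

(** For w the defect of linearity, moving each [T] from the left factor of w^*w onto the right one
    gives w^*w = 0. *)
Lemma symmetric_opP (l : R[i]) T x y :
  symmetric_op T -> T (l *: x + y) = l *: T x + T y.
Proof.
move=> sT; apply/eqP; rewrite -subr_eq0; apply/eqP/starM_eq0.
set w := (X in amul _ X).
rewrite {1}/w astarD astarN amulDl amulNl sT.
by rewrite !(astarD, astarZ, amulDl, amulZl) !sT subrr.
Qed.

Lemma symmetric_opD T x y : symmetric_op T -> T (x + y) = T x + T y.
Proof. by move=> sT; rewrite -{1}[x]scale1r symmetric_opP // scale1r. Qed.

Lemma symmetric_op0 T : symmetric_op T -> T 0 = 0.
Proof.
by move=> sT; apply/(addrI (T 0)); rewrite -symmetric_opD // !addr0.
Qed.

Lemma symmetric_opZ (l : R[i]) T x :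
  symmetric_op T -> T (l *: x) = l *: T x.
Proof.
by move=> sT; rewrite -[l *: x]addr0 symmetric_opP // symmetric_op0 // addr0.
Qed.

Lemma symmetric_iter n T : symmetric_op T -> symmetric_op (iter n T).
Proof. by move=> sT; elim: n => // n IH x y; rewrite /= sT IH -iterSr. Qed.

Lemma symmetric_scale (r : R) T :
  symmetric_op T -> symmetric_op (fun x => r%:C *: T x).
Proof. by move=> sT x y; rewrite astar_real amulZl amulZr sT. Qed.

Lemma symmetric_affine (r : R) a :
  astar a = a -> symmetric_op (fun x => r%:C *: x + amul a x).
Proof.
move=> sa x y; rewrite astarD astar_real astarM sa amulDl amulDr amulZl amulZr.
by rewrite amulA.
Qed.

Lemma symmetric_op_sqr T x :
  symmetric_op T -> anorm (T x) ^+ 2 <= anorm x * anorm (T (T x)).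
Proof.
by move=> sT; rewrite -anorm_starM sT -[anorm x]anorm_star anorm_mul.
Qed.

(* With [w = x - S^2 x], [v = 2 S x] and [y = x + S^2 x] one has
   [w^*w + v^*v = y^*y]. *)
Lemma symmetric_op_amgm S x :
  symmetric_op S -> 2 * anorm (S x) <= anorm (x + S (S x)).
Proof.
move=> sS; rewrite -(@ler_pXn2r _ 2) ?nnegrE ?mulr_ge0 ?anorm_ge0 //.
have v2 : 2 * anorm (S x) = anorm (2%:C *: S x) by rewrite anormZ ger0_norm.
rewrite v2 -[leRHS]anorm_starM.
have -> : amul (astar (x + S (S x))) (x + S (S x)) =
   amul (astar (x - S (S x))) (x - S (S x)) +
   amul (astar (2%:C *: S x)) (2%:C *: S x).
  rewrite astar_real amulZl amulZr scalerA !(astarD, astarN).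
  rewrite !(amulDl, amulDr, amulNl, amulNr) !sS.
  set p := amul _ x; set g := amul _ (S (S x)); set q := amul _ (S (S _)).
  have -> : (2%:C * 2%:C : R[i]) = 4%:R.
    by rewrite -real_complexM -natrM rmorph_nat.
  rewrite scaler_nat (mulrnDr g 2 2) mulr2n opprB (addrACA p (- g)) -opprD.
  by rewrite [RHS]addrA subrK (addrC g q) addrACA.
apply: anorm_sqrD.
rewrite astar_real amulZr amulZl astarD astarN.
rewrite !(amulDl, amulDr, amulNl, amulNr).
by rewrite !sS.
Qed.

(* Factor [1 - S^(2^(n+1))] as [(1 - S^2) (1 + S^2) (1 + S^4) ...]; by AM-GM
   each factor [1 + S^(2j)] dominates [2 S^j]. *)
Lemma symmetric_op_pow_gap S (k : R) :
  symmetric_op S -> 0 <= k -> (forall x, k * anorm x <= anorm (x - S (S x))) ->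
  forall n x,
    k * 2 ^+ n * anorm (iter (2 ^ n).-1 S x) <= anorm (x - iter (2 ^ n.+1) S x).
Proof.
move=> sS k0 Sk; elim=> [|n IH] x; first by rewrite expr0 mulr1 /= Sk.
set U := iter (2 ^ n.+1) S.
have xU : x - iter (2 ^ n.+2) S x = (x + U x) - U (x + U x).
  rewrite symmetric_opD; last exact: symmetric_iter.
  by rewrite opprD addrA addrK /U -iterD addnn -mul2n -expnS.
rewrite {}xU; apply: le_trans (IH _).
set V := iter (2 ^ n) S; set v := iter (2 ^ n).-1 S x.
have -> : iter (2 ^ n).-1 S (x + U x) = v + V (V v).
  rewrite symmetric_opD; last exact: symmetric_iter.
  congr (_ + _); rewrite /U /V /v -!iterD; congr (iter _ S x).
  by rewrite expnS mul2n -addnn addnC -addnA.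
(* The exponents add up: (2^n - 1) + 2^n = 2^(n+1) - 1. *)
have -> : iter (2 ^ n.+1).-1 S x = V v.
  rewrite /V /v -iterD; congr (iter _ S x).
  have : (0 < 2 ^ n)%N by rewrite expn_gt0.
  by rewrite expnS mul2n -addnn; case: (2 ^ n)%N => // m _; rewrite addSn addnS.
rewrite exprSr mulrA -!mulrA ler_wpM2l // ler_wpM2l ?exprn_ge0 //.
by apply: symmetric_op_amgm; exact: symmetric_iter.
Qed.

(** Each halving of the exponent replaces t by its square root, because |S^j x|^2 <= |x| |S^(2j)
    x|. *)
Lemma symmetric_op_root S n (t : R) :
  symmetric_op S -> 0 <= t -> t < 1 ->
  (forall x, anorm (iter (2 ^ n) S x) <= t * anorm x) ->
  exists s : R, [/\ 0 <= s, s < 1 & forall x, anorm (S x) <= s * anorm x].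
Proof.
move=> sS; elim: n t => [|n IH] t t0 t1 St; first by exists t.
apply: (IH (Num.sqrt t)); rewrite ?sqrtr_ge0 //.
  by rewrite -[ltRHS]sqrtr1 ltr_sqrt.
move=> x; rewrite -(@ler_pXn2r _ 2) ?nnegrE ?mulr_ge0 ?sqrtr_ge0 ?anorm_ge0 //.
apply: le_trans (symmetric_op_sqr x (symmetric_iter (2 ^ n) sS)) _.
rewrite -iterD addnn -mul2n -expnS exprMn sqr_sqrtr // expr2 mulrCA.
by rewrite ler_wpM2l ?anorm_ge0.
Qed.

Lemma contraction_iter S n x :
  (forall x, anorm (S x) <= anorm x) -> anorm (iter n S x) <= anorm x.
Proof. by move=> S1; elim: n => //= n; apply: le_trans. Qed.

(** As [S] is a contraction, the gap inequality yields k 2^n |S^(2^n - 1) x| <= 2|x|. Once k 2^n >=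
    4, the power S^(2^n) is bounded by 1/2, and taking roots descends to [S]. *)
Lemma symmetric_op_strict_contraction S (k : R) :
  symmetric_op S -> (forall x, anorm (S x) <= anorm x) -> 0 < k ->
  (forall x, k * anorm x <= anorm (x - S (S x))) ->
  exists s : R, [/\ 0 <= s, s < 1 & forall x, anorm (S x) <= s * anorm x].
Proof.
move=> sS S1 k0 Sk.
have [n n4] : exists n, 4 <= k * 2 ^+ n.
  exists (Num.bound (4 / k)); rewrite mulrC -ler_pdivrMr //.
  apply: le_trans (ltW (archi_boundP _)) _; first by rewrite divr_ge0 // ltW.
  by rewrite -natrX ler_nat ltnW // ltn_expl.
apply: (@symmetric_op_root S n 2^-1) => //; first lra.
move=> x.
have := symmetric_op_pow_gap sS (ltW k0) Sk n x.
have := anormB x (iter (2 ^ n.+1) S x).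
have := contraction_iter (2 ^ n.+1) x S1.
have : anorm (iter (2 ^ n) S x) <= anorm (iter (2 ^ n).-1 S x).
  by rewrite -[in leLHS](prednK (expn_gt0 2 n)) S1.
have := ler_wpM2r (anorm_ge0 (iter (2 ^ n).-1 S x)) n4.
by lra.
Qed.

(* The norm of a symmetric operator is attained in its approximate point
   spectrum: at the infimum [h] of the bounds, [T / h] would otherwise be a
   strict contraction. *)
Lemma symmetric_op_bound T (C r : R) :
  symmetric_op T -> 0 <= r -> (forall x, anorm (T x) <= C * anorm x) ->
  (forall h, r < h ->
     exists2 k : R, 0 < k & forall x, k * anorm x <= anorm (h%:C *: x - T x)) ->
  (forall h, r < h ->
     exists2 k : R, 0 < k & forall x, k * anorm x <= anorm (h%:C *: x + T x)) ->
  forall x, anorm (T x) <= r * anorm x.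
Proof.
move=> sT r0 TC Tm Tp.
(* The constraint [r <= h] keeps [E] bounded below even if A = 0; it remains to show inf E <= r. *)
pose E := [set h : R | r <= h /\ forall x, anorm (T x) <= h * anorm x].
have Er : lbound E r by move=> h [].
have E0 : E !=set0.
  exists (Num.max r C); split=> [|x]; first by rewrite le_max lexx.
  by apply: le_trans (TC x) _; rewrite ler_wpM2r ?anorm_ge0 // le_max lexx orbT.
have rE : r <= inf E by exact: lb_le_inf.
have TE x : anorm (T x) <= inf E * anorm x.
  have [->|x0] := eqVneq x 0; first by rewrite symmetric_op0 // anorm0 mulr0.
  have xp : 0 < anorm x by rewrite lt_def anorm_eq0 x0 anorm_ge0.
  rewrite -ler_pdivrMr //; apply: lb_le_inf => // h [_ hT].
  by rewrite ler_pdivrMr.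
have [rltE|] := ltP r (inf E); last first.
  by move=> Ele x; apply: le_trans (TE x) _; rewrite ler_wpM2r ?anorm_ge0.
exfalso; set h := inf E in rltE TE.
have h0 : 0 < h by apply: le_lt_trans rltE.
have hV0 : 0 <= h^-1 by rewrite invr_ge0 ltW.
have [k1 k10 T1] := Tm _ rltE; have [k2 k20 T2] := Tp _ rltE.
pose S x := (h^-1)%:C *: T x.
have sS : symmetric_op S by exact: symmetric_scale.
have S1 x : anorm (S x) <= anorm x.
  by rewrite /S anormZ ger0_norm // ler_pdivrMl.
(* Here x - S^2 x = h^(-2) (h - T)(h + T) x, and both factors are bounded below. *)
have Sk x : (k1 * k2 / h ^+ 2) * anorm x <= anorm (x - S (S x)).
  have -> : x - S (S x) = ((h ^+ 2)^-1)%:C *: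
      (h%:C *: (h%:C *: x + T x) - T (h%:C *: x + T x)).
    rewrite [T (_ + _)]symmetric_opP // [h%:C *: (_ + _)]scalerDr opprD addrA.
    rewrite addrK scalerBr.
    rewrite !scalerA -!real_complexM /S (symmetric_opZ _ _ sT) scalerA.
    rewrite -real_complexM.
    by rewrite -expr2 mulVf ?expf_neq0 ?gt_eqF // scale1r expr2 invfM.
  rewrite anormZ ger0_norm ?invr_ge0 ?exprn_ge0 ?(ltW h0) // mulrAC mulrC.
  rewrite ler_wpM2l ?invr_ge0 ?exprn_ge0 ?(ltW h0) // -mulrA.
  by apply: le_trans (T1 _); rewrite ler_wpM2l ?T2 ?(ltW k10).
have kp : 0 < k1 * k2 / h ^+ 2 by rewrite divr_gt0 ?mulr_gt0 ?exprn_gt0.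
have [s [s0 s1 Ss]] := symmetric_op_strict_contraction sS S1 kp Sk.
(* As r < h and s < 1, this element of [E] lies strictly below the infimum h. *)
have : E (Num.max r (s * h)).
  split=> [|x]; first by rewrite le_max lexx.
  apply: le_trans (_ : s * h * anorm x <= _).
    have := Ss x; rewrite /S anormZ ger0_norm //.
    by rewrite ler_pdivrMl // mulrCA mulrA.
  by rewrite ler_wpM2r ?anorm_ge0 // le_max lexx orbT.
move=> /(ge_inf (ex_intro _ r Er)); apply/negP; rewrite -ltNge gt_max rltE /=.
by rewrite gtr_pMl.
Qed.

(** As -h is outside the spectrum, h + a has an inverse (b, z) in the unitization. With y = hx + ax
    this gives x = by + zy, so |x| <= (|b| + |z|) |y|. *)
Lemma apositive_bounded_below a (h : R) : apositive a -> 0 < h ->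
  exists2 k : R, 0 < k & forall x, k * anorm x <= anorm (h%:C *: x + amul a x).
Proof.
move=> [_ sp] h0.
have /contrapT[[b z] [_ [/= e1 e2]]] : ~ spectrum a (- h%:C).
  by move/sp; rewrite oppr_ge0 lecE /= eqxx leNgt h0.
rewrite opprK in e1 e2.
pose q := anorm b + complex.Re `|z|.
(* The scalar component of the inverse satisfies z h = 1, so z is nonzero. *)
have q0 : 0 < q.
  rewrite ltr_wpDl ?anorm_ge0 // -ltcR RRe_real ?ger0_real // normr_gt0.
  by apply: contraTneq (oner_neq0 R[i]) => z0; rewrite -e2 z0 mul0r eqxx.
exists q^-1; rewrite ?invr_gt0 // => x; rewrite ler_pdivrMl //.
set y := h%:C *: x + amul a x.
have -> : x = amul b y + z *: y.
  rewrite /y amulDr amulZr scalerDr scalerA e2 scale1r amulA -amulZl.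
  rewrite (addrC x) addrA -(amulZl z) -!amulDl [h%:C *: b + _]addrC e1.
  by rewrite amul0l add0r.
apply: le_trans (anormD _ _) _; rewrite anormZl mulrDl lerD2r.
exact: anorm_mul.
Qed.

(** For T = t - a and h > t, the operator h - T = (h - t) + a is bounded below by positivity, and h
    + T = (h + t) - a because h + t > |a|. *)
Lemma apositive_shift_le a (t : R) x : apositive a -> anorm a <= t ->
  anorm (t%:C *: x - amul a x) <= t * anorm x.
Proof.
move=> pa at_; have t0 := le_trans (anorm_ge0 a) at_.
have ax y : anorm (amul a y) <= anorm a * anorm y by exact: anorm_mul.
have tx (r : R) y : 0 <= r -> anorm (r%:C *: y) = r * anorm y.
  by move=> r0; rewrite anormZ ger0_norm.
pose T y := t%:C *: y + amul (- a) y.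
have TE y : T y = t%:C *: y - amul a y by rewrite /T amulNl.
have sT : symmetric_op T.
  by apply: symmetric_affine; rewrite astarN; case: pa => ->.
rewrite -TE; apply: (@symmetric_op_bound T (t + anorm a)) => // [y|h th|h th].
- rewrite TE mulrDl; apply: le_trans (anormB _ _) _.
  by rewrite tx // lerD2l.
- have ht0 : 0 < h - t by rewrite subr_gt0.
  have [k k0 ak] := apositive_bounded_below pa ht0; exists k => // y.
  apply: le_trans (ak y) _; rewrite TE opprB addrCA real_complexB scalerBl.
  by rewrite addrC.
- exists (h + t - anorm a) => [|y]; first by lra.
  rewrite TE addrA -scalerDl -rmorphD /=.
  have := anorm_leB ((h + t)%:C *: y) (amul a y); rewrite tx; last by lra.
  by have := ax y; lra.
Qed.

(** Left multiplication by a is bounded by |z|, where z = a + b. For h > |z| and t = |b|, write h -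
    a = (h + t) - (t - b) - z and use that t - b is bounded by t; h + a is bounded below by
    positivity. *)
Lemma apositive_norm_leD a b :
  apositive a -> apositive b -> anorm a <= anorm (a + b).
Proof.
move=> pa pb; set z := a + b.
have abound x : anorm (amul a x) <= anorm z * anorm x.
  apply: (@symmetric_op_bound (amul a) (anorm a)) => [u v|||h zh|h zh].
  - by rewrite astarM amulA; case: pa => ->.
  - exact: anorm_ge0.
  - by move=> y; exact: anorm_mul.
  - exists (h - anorm z) => [|y]; first by rewrite subr_gt0.
    set t := anorm b; have t0 : 0 <= t by exact: anorm_ge0.
    have ht : 0 <= h + t.
      by rewrite addr_ge0 // ltW // (le_lt_trans _ zh) ?anorm_ge0.
    have := apositive_shift_le y pb (lexx t).
    have := anorm_mul z y.
    have := anormD (t%:C *: y - amul b y) (amul z y).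
    have := anorm_leB ((h + t)%:C *: y) (t%:C *: y - amul b y + amul z y).
    have -> : (h + t)%:C *: y - (t%:C *: y - amul b y + amul z y) =
        h%:C *: y - amul a y.
      rewrite /z amulDl rmorphD /= scalerDl !opprD opprK.
      rewrite -!addrA; congr (_ + _).
      by rewrite [amul b y + _]addrCA subrr addr0 addrA subrr add0r.
    rewrite anormZ ger0_norm //.
    by move=> *; lra.
  - have h0 : 0 < h by rewrite (le_lt_trans _ zh) ?anorm_ge0.
    exact: apositive_bounded_below.
have [->|a0] := eqVneq a 0; first by rewrite anorm0 anorm_ge0.
have ap : 0 < anorm a by rewrite lt_def anorm_eq0 a0 anorm_ge0.
(* Evaluating the operator bound at x = a turns it into a bound on |a|. *)
have aa : anorm (amul a a) = anorm a * anorm a.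
  by rewrite -expr2 -anorm_starM; case: pa => ->.
by rewrite -(ler_pM2r ap) -aa.
Qed.

End CStarAlgebraTheory.

(** * Inner products and their limits *)

Section PreHilbertModuleTheory.
Context {R : realType} {A : cstarAlgType R} {M : preHilbertModType A}.
Implicit Types (x y z : M).

Lemma innerDl x y z : inner (x + y) z = inner x z + inner y z :> A.
Proof. by have := inner_linearl 1 x y z; rewrite !scale1r. Qed.

Lemma inner0l z : inner 0 z = 0 :> A.
Proof. by apply/(addrI (inner 0 z)); rewrite -innerDl !addr0. Qed.

Lemma innerZl (l : R[i]) x z : inner (l *: x) z = l *: inner x z :> A.
Proof. by have := inner_linearl l x 0 z; rewrite !addr0 inner0l addr0. Qed.

Lemma innerNl x z : inner (- x) z = - inner x z :> A.
Proof. by rewrite -scaleN1r innerZl scaleN1r. Qed.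

Lemma innerDr x y z : inner x (y + z) = inner x y + inner x z :> A.
Proof. by rewrite -inner_star innerDl astarD !inner_star. Qed.

Lemma innerZr (l : R[i]) x y : inner x (l *: y) = Num.conj l *: inner x y :> A.
Proof. by rewrite -inner_star innerZl astarZ inner_star. Qed.

Lemma inner_realr (r : R) x y : inner x (r%:C *: y) = r%:C *: inner x y :> A.
Proof. by rewrite -inner_star innerZl astar_real inner_star. Qed.

Lemma inner_real (r s : R) x y :
  inner (r%:C *: x) (s%:C *: y) = (r * s)%:C *: inner x y :> A.
Proof. by rewrite innerZl inner_realr scalerA -real_complexM. Qed.

Lemma innerNr x y : inner x (- y) = - inner x y :> A.
Proof. by rewrite -inner_star innerNl astarN inner_star. Qed.

Lemma inner_actr a x y : inner x (act a y) = amul (inner x y) (astar a) :> A.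
Proof. by rewrite -inner_star inner_actl astarM inner_star. Qed.

Lemma anorm_inner_sym x y : anorm (inner x y : A) = anorm (inner y x : A).
Proof. by rewrite -inner_star anorm_star. Qed.

Lemma inner_parallelogram x y :
  inner (x + y) (x + y) + inner (x - y) (x - y) =
  (inner x x + inner y y) *+ 2 :> A.
Proof.
rewrite !(innerDl, innerDr, innerNl, innerNr) opprK addrACA.
rewrite (addrACA _ _ (inner x x)) subrr addr0.
rewrite (addrACA _ _ (- inner y x)) subrr add0r.
by rewrite mulr2n addrACA.
Qed.

(** * Norm inequalities and Cauchy-Schwarz *)

Lemma hnorm_ge0 x : 0 <= hnorm x.
Proof. exact: sqrtr_ge0. Qed.

Lemma hnorm_sqr x : hnorm x ^+ 2 = anorm (inner x x : A).
Proof. by rewrite sqr_sqrtr ?anorm_ge0. Qed.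

Lemma hnorm_eq0 x : hnorm x = 0 -> x = 0.
Proof.
move=> x0; apply/(@inner_eq0 R A M)/eqP.
by rewrite -anorm_eq0 -hnorm_sqr x0 expr0n.
Qed.

Lemma hnormZ (r : R) x : hnorm (r%:C *: x) ^+ 2 = r ^+ 2 * hnorm x ^+ 2.
Proof.
by rewrite !hnorm_sqr inner_real anormZ -expr2 ger0_norm // sqr_ge0.
Qed.

Lemma anorm_parallelogram x y :
  anorm (inner (x + y) (x + y) + inner (x - y) (x - y) : A) <=
  2 * (hnorm x ^+ 2 + hnorm y ^+ 2).
Proof.
rewrite inner_parallelogram mulr2n !hnorm_sqr mulr_natl mulr2n.
by apply: le_trans (anormD _ _) _; rewrite lerD // anormD.
Qed.

(** Adding the positive element <x - y, x - y> can only increase the norm, and the parallelogram law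
    bounds the sum. This serves in place of the triangle inequality. *)
Lemma hnorm_sqrD x y : hnorm (x + y) ^+ 2 <= 2 * (hnorm x ^+ 2 + hnorm y ^+ 2).
Proof.
apply: le_trans (anorm_parallelogram x y); rewrite hnorm_sqr.
exact: apositive_norm_leD (inner_ge0 _) (inner_ge0 _).
Qed.

Lemma hnorm_sqrB x y : hnorm (x - y) ^+ 2 <= 2 * (hnorm x ^+ 2 + hnorm y ^+ 2).
Proof.
apply: le_trans (anorm_parallelogram x y).
rewrite (addrC (inner (x + y) _)) hnorm_sqr.
exact: apositive_norm_leD (inner_ge0 _) (inner_ge0 _).
Qed.

(* With [b = <x, y>] and [w = t b y], the elements [<x + w, x + w>] and
   [<x - w, x - w>] are positive and differ by [4 t b b^*]; take
   [t = 1/(2|y|^2)]. The constant 4 is not optimal. *)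
Lemma anorm_inner_sqr x y :
  anorm (inner x y : A) ^+ 2 <= 4 * (hnorm x ^+ 2 * hnorm y ^+ 2).
Proof.
have [->|y0] := eqVneq y 0.
  rewrite anorm_inner_sym inner0l anorm0 expr0n /=.
  by rewrite mulr_ge0 // mulr_ge0 // sqr_ge0.
have q0 : 0 < hnorm y ^+ 2.
  rewrite exprn_gt0 // lt_def hnorm_ge0 andbT.
  by apply: contraNneq y0 => /hnorm_eq0 ->.
set q := hnorm y ^+ 2 in q0 *; set p := hnorm x ^+ 2.
set b : A := inner x y; pose t := (2 * q)^-1.
have t0 : 0 < t by rewrite invr_gt0 mulr_gt0.
pose w := t%:C *: act b y.
have bE : anorm (amul b (astar b)) = anorm b ^+ 2.
  by rewrite -{1}[b]astarK anorm_starM anorm_star.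
have xw : inner x w = t%:C *: amul b (astar b) :> A.
  by rewrite /w inner_realr inner_actr.
have wx : inner w x = inner x w :> A.
  by rewrite -inner_star xw astar_real astarM astarK.
have wE : hnorm w ^+ 2 <= t ^+ 2 * (anorm b ^+ 2 * q).
  rewrite /w hnormZ ler_wpM2l ?sqr_ge0 // hnorm_sqr inner_actl inner_actr.
  apply: le_trans (anorm_mul _ _) _.
  rewrite expr2 -mulrA ler_wpM2l ?anorm_ge0 //.
  by apply: le_trans (anorm_mul _ _) _; rewrite anorm_star mulrC -hnorm_sqr.
have dE : inner (x + w) (x + w) - inner (x - w) (x - w) =
    (4 * t)%:C *: amul b (astar b) :> A.
  rewrite !(innerDl, innerDr, innerNl, innerNr) opprK wx.
  rewrite real_complexM -scalerA -xw rmorph_nat scaler_nat.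
  rewrite (mulrnDr _ 2 2) mulr2n.
  set p' := inner x x; set g := inner x w; set r := inner w w.
  rewrite (addrC g r) (addrC (- g) r) (addrACA p' g) (addrACA p' (- g)).
  by rewrite opprD [LHS]addrACA subrr add0r opprD !opprK.
have := anormB (inner (x + w) (x + w) : A) (inner (x - w) (x - w)).
rewrite dE anormZ ger0_norm ?mulr_ge0 ?(ltW t0) // bE -!hnorm_sqr.
have := hnorm_sqrD x w; have := hnorm_sqrB x w.
move: wE; rewrite -/p; set B := anorm b ^+ 2.
(* With tq = 1/2, the bounds read 4tB <= 4p + 4|w|^2 and |w|^2 <= tB/2, whence tB <= 2p. *)
have tq : t * q = 2^-1 by rewrite /t; field; rewrite gt_eqF.
have -> : t ^+ 2 * (B * q) = t * q * (t * B) by ring.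
rewrite tq => *.
have : t * B <= 2 * p by lra.
by rewrite /t invfM -mulrA ler_pdivrMl // ler_pdivrMl //; lra.
Qed.

Lemma anorm_inner x y : anorm (inner x y : A) <= 2 * (hnorm x * hnorm y).
Proof.
rewrite -(@ler_pXn2r _ 2) ?nnegrE ?anorm_ge0 ?mulr_ge0 ?hnorm_ge0 //.
by apply: le_trans (anorm_inner_sqr x y) _; rewrite !exprMn; lra.
Qed.

End PreHilbertModuleTheory.

(** * Maps preserving the inner product *)

Section InnerPreserving.
Context {R : realType} {A : cstarAlgType R} {M N : preHilbertModType A}.

Lemma act0 (x : M) : act 0 x = 0.
Proof. by apply/(addrI (act (0 : A) x)); rewrite -actDl !addr0. Qed.

(** Let u = I(ax + ly + z) and let v be the expected value. Then <u, I t> = <v, I t> for all t, and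
    u, v are themselves combinations of values of I, so <u - v, u - v> = 0. *)
Lemma inner_preserving_Alinear (I : M -> N) :
  (forall x y, inner (I x) (I y) = inner x y :> A) -> Alinear I.
Proof.
move=> HI a l x y z; apply/eqP; rewrite -subr_eq0; apply/eqP.
set u := I _; set v := act a _ + _ + _.
have uI t : inner u (I t) = inner v (I t) :> A.
  by rewrite /u /v HI !(innerDl, innerZl, inner_actl) !HI.
have uv : inner u v = inner v v :> A.
  by rewrite {1 3}/v !(innerDr, innerZr, inner_actr) !uI.
have uu : inner u u = inner v u :> A by exact: uI.
clearbody u v; apply/(@inner_eq0 R A N).
by rewrite innerDl innerNl !(innerDr, innerNr) uu uv subrr.
Qed.

Lemma inner_preserving_isometry (I : M -> N) :
  (forall x y, inner (I x) (I y) = inner x y :> A) -> hisometry I.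
Proof.
move=> HI x y; rewrite /hnorm !(innerDl, innerNl).
by rewrite !(innerDr, innerNr) !HI.
Qed.
End InnerPreserving.

Section AlinearTheory.
Context {R : realType} {A : cstarAlgType R} {M N : preHilbertModType A}.

Lemma Alinear0 (I : M -> N) : Alinear I -> I 0 = 0.
Proof.
move=> linI; apply/(addrI (I 0)).
by have := linI 0 1 0 0 0; rewrite !scale1r !act0 !add0r addr0 => <-.
Qed.

Lemma AlinearZ (I : M -> N) (l : R[i]) x : Alinear I -> I (l *: x) = l *: I x.
Proof.
move=> linI; have := linI 0 l 0 x 0.
by rewrite !act0 Alinear0 // !add0r !addr0.
Qed.
End AlinearTheory.

(** * Passing to the limit in inner products *)

Section InnerLimit.
Context {R : realType} {A : cstarAlgType R}.

Lemma cvg0_le0 (a : R) (u : nat -> R) :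
  (forall n, a <= u n) -> u n @[n --> \oo] --> (0 : R) -> a <= 0.
Proof.
move=> au u0; rewrite -(cvg_lim _ u0) //.
by apply: limr_ge; [apply/cvg_ex; exists 0|exact: nearW].
Qed.

(** Writing u_n = a + u' and v_n = b + v', Cauchy-Schwarz bounds the three error terms, so the
    constant |<a, b> - w| lies below a null sequence. *)
Lemma inner_limit_eq {N : preHilbertModType A} (u v : nat -> N) a b (w : A) :
  hnorm (u n - a) @[n --> \oo] --> (0 : R) ->
  hnorm (v n - b) @[n --> \oo] --> (0 : R) ->
  anorm (inner (u n) (v n) - w) @[n --> \oo] --> (0 : R) ->
  inner a b = w.
Proof.
move=> ua vb uv; apply/eqP; rewrite -subr_eq0 -anorm_eq0 eq_le anorm_ge0 andbT.
pose p n := hnorm (u n - a); pose q n := hnorm (v n - b).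
apply: (@cvg0_le0 _ (fun n => anorm (inner (u n) (v n) - w) +
   (2 * (hnorm a * q n) + 2 * (p n * hnorm b) + 2 * (p n * q n)))); last first.
  rewrite [X in _ --> X](_ : _ = 0 + (2 * (hnorm a * 0) +
     2 * (0 * hnorm b) + 2 * (0 * 0))); last by rewrite !(mulr0, mul0r, addr0).
  apply: cvgD => //; apply: cvgD; [apply: cvgD|].
  - by apply: cvgMr; apply: cvgMr.
  - by apply: cvgMr; apply: cvgMl.
  - by apply: cvgMr; apply: cvgM.
move=> n /=.
have uE : u n = a + (u n - a) by rewrite addrC subrK.
have vE : v n = b + (v n - b) by rewrite addrC subrK.
have := anorm_inner a (v n - b); have := anorm_inner (u n - a) b.
have := anorm_inner (u n - a) (v n - b); rewrite -/(p n) -/(q n).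
move: (u n - a) (v n - b) uE vE => u' v' -> ->.
rewrite !(innerDl, innerDr).
set x := inner a b; set y := inner a v'.
set z := inner u' b; set t := inner u' v'.
have -> : x - w = (x + y + (z + t) - w) - (y + z + t).
  rewrite addrAC; congr (_ - w); apply/esym/eqP.
  by rewrite subr_eq -(addrA y) -!addrA.
move=> *; apply: le_trans (anormB _ _) _; rewrite lerD2l.
apply: le_trans (anormD _ _) _; apply: lerD => //.
by apply: le_trans (anormD _ _) _; exact: lerD.
Qed.
End InnerLimit.

(* Nothing is assumed of [g n 0]; the value [I 0 = 0] is imposed. *)
Lemma exists_inner_preserving_limit {R : realType} {A : cstarAlgType R}
    {M : preHilbertModType A} {N : hilbertModType A} (g : nat -> M -> N) :
  (forall x y, x != 0 -> y != 0 -> forall e : R, 0 < e ->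
     exists K, forall m n, (K <= m)%N -> (K <= n)%N ->
       anorm (inner (g m x) (g n y) - inner x y : A) < e) ->
  exists I : M -> N, (forall x y, inner (I x) (I y) = inner x y :> A) /\
    forall x, x != 0 -> hnorm (g n x - I x) @[n --> \oo] --> (0 : R).
Proof.
move=> gP.
have lim_g x : exists z : N, (x = 0 -> z = 0) /\
    (x != 0 -> hnorm (g n x - z) @[n --> \oo] --> (0 : R)).
  have [->|x0] := eqVneq x 0; first by exists 0.
  have [e e0|z gz] := @hnorm_complete R A N (g^~ x); last first.
    by exists z; split=> // x0'; rewrite x0' eqxx in x0.
  (* The square of |g_m x - g_n x| is an alternating sum of four inner products, each within e^2/4
     of <x, x>. *)
  have [|K gK] := gP _ _ x0 x0 (e ^+ 2 / 4).
    by rewrite divr_gt0 ?exprn_gt0.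
  exists K => m n Km Kn.
  rewrite -(@ltr_pXn2r _ 2) ?nnegrE ?hnorm_ge0 ?(ltW e0) // hnorm_sqr.
  set i := inner x x in gK.
  have -> : inner (g m x - g n x) (g m x - g n x) =
      (inner (g m x) (g m x) - i) - (inner (g m x) (g n x) - i) -
      ((inner (g n x) (g m x) - i) - (inner (g n x) (g n x) - i)) :> A.
    rewrite innerDl innerNl !(innerDr, innerNr).
    have sub_i (a b : A) : (a - i) - (b - i) = a - b.
      by rewrite opprB addrA subrK.
    by rewrite !sub_i.
  have := anormB (inner (g m x) (g m x) - i) (inner (g m x) (g n x) - i).
  have := anormB (inner (g n x) (g m x) - i) (inner (g n x) (g n x) - i).
  have := gK _ _ Km Km; have := gK _ _ Km Kn.
  have := gK _ _ Kn Km; have := gK _ _ Kn Kn => *.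
  by apply: le_lt_trans (anormB _ _) _; lra.
have [I IP] := choice lim_g.
have I0 : I 0 = 0 by case: (IP 0) => ->.
exists I; split=> [x y|x]; last by case: (IP x).
have [->|x0] := eqVneq x 0; first by rewrite I0 !inner0l.
have [->|y0] := eqVneq y 0.
  by rewrite I0 -inner_star inner0l -[RHS]inner_star inner0l.
apply: (inner_limit_eq ((IP x).2 x0) ((IP y).2 y0)).
apply/cvgr0Pnorm_lt => e e0; have [K gK] := gP _ _ x0 y0 _ e0.
by exists K => // n Kn; rewrite /= ger0_norm ?anorm_ge0 // gK.
Qed.

(** * Rescalings of a map *)

Section Rescaling.
Context {R : realType} {A : cstarAlgType R} {M N : preHilbertModType A}.
Context (c : R) (f : M -> N).

Definition rescale (n : nat) (x : M) : N :=
  (c ^+ n)%:C *: f ((c ^- n)%:C *: x).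

Lemma scale_real_expK (V : lmodType R[i]) n (x : V) :
  c != 0 -> (c ^+ n)%:C *: ((c ^- n)%:C *: x) = x.
Proof.
by move=> c0; rewrite scalerA -real_complexM mulfV ?expf_neq0 // scale1r.
Qed.

(** Lets the rescaling start from c^(-k) x, which lies in Delta for suitable k even when x does
    not. *)
Lemma rescaleD k n x :
  rescale (k + n) x = (c ^+ k)%:C *: rescale n ((c ^- k)%:C *: x).
Proof.
rewrite /rescale !scalerA -!real_complexM -exprD exprD.
by rewrite invfM [_ * c ^- n]mulrC.
Qed.

End Rescaling.

Lemma rescale_linear {R : realType} {A : cstarAlgType R}
    {M N : preHilbertModType A} (c : R) (J : M -> N) n x :
  Alinear J -> c != 0 -> rescale c J n x = J x.
Proof. by move=> linJ c0; rewrite /rescale AlinearZ // scale_real_expK. Qed.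

(** * Existence, orthogonality and uniqueness of the isometry *)

Theorem theorem2p1 (R : realType) (A : cstarAlgType R)
  (M : preHilbertModType A) (N : hilbertModType A)
  (D : set (M * M)) (c : R) (phi : M -> M -> R) (f : M -> N) :
  let Delta : set M := [set x | D (x, x)] in
  (Delta `*` Delta `<=` D) ->
  0 < c -> c != 1 ->
  (forall (x y : M) (m n : nat), D (x, y) ->
     D ((c ^- n)%:C *: x, (c ^- m)%:C *: y)) ->
  (forall x y : M, x != 0 -> y != 0 ->
     exists m n : nat, D ((c ^- n)%:C *: x, (c ^- m)%:C *: y)) ->
  (forall x y : M, 0 <= phi x y) ->
  (forall x y : M, D (x, y) ->
     c ^+ (p.1 + p.2) * phi ((c ^- p.1)%:C *: x) ((c ^- p.2)%:C *: y)
       @[p --> sum_oo] --> (0 : R)) ->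
  (forall x y : M, D (x, y) ->
     anorm ((inner (f x) (f y) : A) - inner x y) <= phi x y) ->
  exists! I : M -> N,
    [/\ Alinear I, hisometry I &
      exists T : M -> N, forall x y : M, Delta x -> Delta y ->
        [/\ f x = I x + T x,
            hnorm (f x - I x) <= Num.sqrt (phi x x),
            hnorm (T x) <= Num.sqrt (phi x x) &
            (inner (T x) (I y) : A) = 0]].
Proof.
move=> Delta DeltaD c0 _ Dscale Dabsorb phi0 phi_cvg fphi.
have cn0 : c != 0 by rewrite gt_eqF.
pose g := rescale c f.
have phi_lt x y (e : R) : D (x, y) -> 0 < e ->
    exists K, forall m n, (K <= m + n)%N ->
    c ^+ (m + n) * phi ((c ^- m)%:C *: x) ((c ^- n)%:C *: y) < e.
  move=> Dxy e0; have /cvgr0Pnorm_lt/(_ e e0)[K HK] := phi_cvg _ _ Dxy.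
  exists K => m n Kmn; have := HK (m, n) Kmn => /=.
  by rewrite ger0_norm // mulr_ge0 // exprn_ge0 // ltW.
have inner_scale (x y : M) m n : inner x y = (c ^+ (m + n))%:C *:
    inner ((c ^- m)%:C *: x) ((c ^- n)%:C *: y) :> A.
  by rewrite exprD -inner_real !scale_real_expK.
have g_phi x y m n : D (x, y) ->
    anorm (inner (g m x) (g n y) - inner x y : A) <=
    c ^+ (m + n) * phi ((c ^- m)%:C *: x) ((c ^- n)%:C *: y).
  move=> Dxy; rewrite (inner_scale x y m n).
  rewrite /g /rescale inner_real -exprD -scalerBr anormZ.
  rewrite ger0_norm ?exprn_ge0 ?(ltW c0) // ler_wpM2l ?exprn_ge0 ?(ltW c0) //.
  by apply: fphi; exact: Dscale.
(* [Dabsorb] gives exponents n and m on the two sides; scaling further by k + m and k + n makes both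
   equal to k + n + m. *)
have absorb1 x : x != 0 -> exists k, forall n, Delta ((c ^- (n + k))%:C *: x).
  move=> x0; have [m [n Dmn]] := Dabsorb _ _ x0 x0.
  exists (n + m)%N => k; have := Dscale _ _ (k + n)%N (k + m)%N Dmn.
  rewrite !scalerA -!real_complexM -!invfM -!exprD.
  by rewrite -addnA [(m + n)%N]addnC -addnA.
have absorb x y : x != 0 -> y != 0 ->
    exists k, Delta ((c ^- k)%:C *: x) /\ Delta ((c ^- k)%:C *: y).
  move=> /absorb1[k xk] /absorb1[l yl]; exists (l + k)%N.
  by split; [exact: xk|rewrite addnC; exact: yl].
have g_inner x y : x != 0 -> y != 0 -> forall e : R, 0 < e ->
    exists K, forall m n, (K <= m)%N -> (K <= n)%N ->
       anorm (inner (g m x) (g n y) - inner x y : A) < e.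
  move=> x0 y0 e e0; have [k [xk yk]] := absorb _ _ x0 y0.
  have Dk : D ((c ^- k)%:C *: x, (c ^- k)%:C *: y) by exact: DeltaD.
  have ck0 : 0 < c ^+ (k + k) by rewrite exprn_gt0.
  (* Passing from c^(-k) x and c^(-k) y back to x and y multiplies the error by c^(2k). *)
  have [|K HK] := phi_lt _ _ (e / c ^+ (k + k)) Dk; first by rewrite divr_gt0.
  exists (k + K)%N => m n Km Kn.
  rewrite -(subnKC (leq_trans (leq_addr K k) Km)).
  rewrite -(subnKC (leq_trans (leq_addr K k) Kn)) /g !rescaleD.
  rewrite (inner_scale x y k k) inner_real -exprD -scalerBr anormZ.
  rewrite (ger0_norm (ltW ck0)) mulrC.
  rewrite -ltr_pdivlMr //; apply: le_lt_trans (g_phi _ _ _ _ Dk) _.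
  apply: HK; apply: leq_trans (leq_addr _ _).
  by rewrite -(leq_add2l k) subnKC // (leq_trans (leq_addr K k)).
have [I [I_inner gI]] := exists_inner_preserving_limit g_inner.
have linI := inner_preserving_Alinear I_inner.
have If x y : Delta x -> Delta y -> inner (I x) (f y) = inner x y :> A.
  move=> Dx Dy; have [->|x0] := eqVneq x 0.
    by rewrite Alinear0 // !inner0l.
  (* The second index stays at 0, where the rescaling of f is f itself; the sum n + 0 still tends to
     infinity. *)
  apply: (inner_limit_eq (v := fun=> f y) (gI _ x0)).
    by rewrite /= subrr /hnorm inner0l anorm0 sqrtr0; exact: cvg_cst.
  have Dxy : D (x, y) by exact: DeltaD.
  apply/cvgr0Pnorm_lt => e e0; have [K HK] := phi_lt _ _ _ Dxy e0.
  exists K => // n Kn; rewrite /= ger0_norm ?anorm_ge0 //.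
  have := g_phi _ _ n 0%N Dxy; rewrite /g /rescale expr0 invr1 !scale1r.
  move/le_lt_trans; apply; have := HK n 0%N.
  by rewrite addn0 expr0 invr1 scale1r; apply.
have fI x y : Delta x -> Delta y -> inner (f x - I x) (I y) = 0 :> A.
  move=> Dx Dy; rewrite innerDl innerNl I_inner -inner_star If // inner_star.
  by rewrite subrr.
have f_near x : Delta x -> hnorm (f x - I x) <= Num.sqrt (phi x x).
  move=> Dx; rewrite ler_sqrt //.
  (* Pythagoras: f x - I x is orthogonal to I x, and <I x, f x> = <x, x>. *)
  have -> : inner (f x - I x) (f x - I x) = inner (f x) (f x) - inner x x :> A.
    by rewrite innerDr innerNr fI // subr0 innerDl innerNl If.
  exact: fphi.
exists I; split.
  split=> //; first exact: inner_preserving_isometry.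
  exists (fun x => f x - I x) => x y Dx Dy; split; rewrite ?f_near ?fI //.
  by rewrite addrC subrK.
(* Rescaling fixes the linear J, so g n x - J x is c^n times the value of f - J at c^(-n) x, a point
   that [Dscale] keeps in Delta. *)
have unique_on x (J : M -> N) n : Alinear J -> Delta x ->
    (forall x, Delta x -> hnorm (f x - J x) <= Num.sqrt (phi x x)) ->
    hnorm (g n x - J x) ^+ 2 <=
      c ^+ (n + n) * phi ((c ^- n)%:C *: x) ((c ^- n)%:C *: x).
  move=> linJ Dx fJ; rewrite -(rescale_linear n x linJ cn0) /g /rescale.
  rewrite -scalerBr hnormZ exprD -expr2 ler_wpM2l ?sqr_ge0 //.
  rewrite -[leRHS]sqr_sqrtr // ler_pXn2r ?nnegrE ?hnorm_ge0 ?sqrtr_ge0 //.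
  by apply: fJ; exact: Dscale.
move=> J [linJ _ [T fJT]]; apply/funext => x.
have fJ y : Delta y -> hnorm (f y - J y) <= Num.sqrt (phi y y).
  by move=> Dy; case: (fJT y y Dy Dy).
have IJ y : Delta y -> I y = J y.
  move=> Dy; apply/eqP; rewrite -subr_eq0; apply/eqP/hnorm_eq0/eqP.
  rewrite -sqrf_eq0 eq_le sqr_ge0 andbT; apply/ler_addgt0Pl => e e0.
  (* Both squared distances to g K y are below e/4, and [hnorm_sqrB] gives 2(e/4 + e/4) = e. *)
  have [|K HK] := phi_lt _ _ (e / 4) Dy; first by rewrite divr_gt0.
  have := HK K K (leq_addr _ _).
  have := unique_on y I K linI Dy f_near; have := unique_on y J K linJ Dy fJ.
  have := hnorm_sqrB (g K y - J y) (g K y - I y).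
  have -> : g K y - J y - (g K y - I y) = I y - J y.
    by rewrite opprB addrC addrA subrK.
  by move=> *; lra.
have [->|x0] := eqVneq x 0; first by rewrite !Alinear0.
(* Some c^(-k) carries x into Delta; homogeneity of both maps brings the equality back to x. *)
have [k] := absorb1 _ x0; move=> /(_ 0%N); rewrite add0n => /IJ.
move/(congr1 (fun z => (c ^+ k)%:C *: z)).
by rewrite (AlinearZ _ _ linI) (AlinearZ _ _ linJ) !scale_real_expK.
Qed.
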